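(* Let $p$ be the peak value of the Collatz sequence starting at some positive integer $n$ (assumed to have a maximum), let $u$ be the odd number immediately before $p$ in this sequence, and let $v$ be the odd number immediately after $p$. Suppose $u=2\cdot 4^t k+\frac{4^{t+1}-1}{3}$ with integers $t\ge 1$ and $k\ge 1$. If $k$ is odd, then $2\cdot 4^t\mid p$ and $v=3k+2$.
   Context: The Collatz map $T$ on the positive integers is $T(m)=m/2$ if $m$ is even and $T(m)=3m+1$ if $m$ is odd; $T^i$ denotes its $i$-fold iterate. The Collatz sequence starting at $n$ is the infinite sequence $n, T(n), T^2(n),\dots$. Its peak value is the maximum of all its terms. That $u$ is the odd number immediately before $p$ means that $u$ is odd and, for some $i\ge 0$, $T^i(n)=u$ and $T^{i+1}(n)=T(u)=p$. The odd number $v$ immediately after $p$ is the first odd term of the sequence $T(p),T^2(p),\dots$ (equivalently, the odd part of the even number $p$). *)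

(* Defs.v *)
From mathcomp Require Import all_boot.

Definition collatz (m : nat) : nat := if odd m then 3 * m + 1 else m %/ 2.

Definition is_peak (n p : nat) : Prop :=
  (exists i, iter i collatz n = p) /\ (forall i, iter i collatz n <= p).

Definition odd_before (n p u : nat) : Prop :=
  odd u /\ exists i, iter i collatz n = u /\ iter i.+1 collatz n = p.

(* The search for the first odd term starts at [collatz p], not at [p]. *)
Definition odd_after (p v : nat) : Prop :=
  odd v /\
  exists j, iter j.+1 collatz p = v /\
            forall i, i < j -> ~~ odd (iter i.+1 collatz p).

(* Main.v *)
Require Import Defs.
From mathcomp Require Import all_boot.

(** The step after the odd number [u] gives [p = 3 * u + 1], and the special
    form of [u] makes the constant term a power of 4:
    [3 * ((4 ^ t.+1 - 1) %/ 3) + 1 = 4 ^ t.+1], so that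
    [p = 2 * 4 ^ t * (3 * k + 2)].  For odd [k] the cofactor [3 * k + 2] is
    odd, so [2 * 4 ^ t] is the full power of 2 in [p], and [3 * k + 2] is its
    odd part.  The Collatz map strips factors of 2 one at a time
    ([iter_collatz_pow2]), hence the first odd term after [p] is this odd part
    ([odd_after_odd_part]). *)

Lemma iter_collatz_pow2 (i a w : nat) :
  iter i collatz (2 ^ (a + i) * w) = 2 ^ a * w.
Proof.
elim: i => [|i IHi]; first by rewrite addn0.
rewrite iterSr addnS expnS -mulnA {2}/collatz oddM /=.
by rewrite mulKn.
Qed.

(** The exponent is a successor because the search for the next odd term starts
    one step after [p]: for odd [p] it need not return [p] itself. *)
Lemma odd_after_odd_part (a w v : nat) :
  odd w -> odd_after (2 ^ a.+1 * w) v -> v = w.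
Proof.
move=> odd_w [odd_v [j [def_v even_before]]].
case: (ltngtP j a) => [lt_ja | lt_aj | eq_ja].
- (* Too early: a factor 2 is left. *)
  move: odd_v; rewrite -def_v.
  have -> : a.+1 = (a - j.+1).+1 + j.+1 by rewrite addSn subnK.
  by rewrite iter_collatz_pow2 expnS -mulnA oddM.
- (* Too late: the odd part was already reached at step [a.+1]. *)
  have := even_before a lt_aj.
  by rewrite -[X in 2 ^ X]add0n iter_collatz_pow2 mul1n odd_w.
- by rewrite -def_v eq_ja -[X in 2 ^ X]add0n iter_collatz_pow2 mul1n.
Qed.

Lemma collatz_special_form (t k : nat) :
  3 * (2 * 4 ^ t * k + (4 ^ t.+1 - 1) %/ 3) + 1 = 2 * 4 ^ t * (3 * k + 2).
Proof.
have dvd3 : 3 %| 4 ^ t.+1 - 1.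
  by rewrite subn1 (predn_exp 4) dvdn_mulr.
rewrite mulnDr [3 * (_ %/ 3)]mulnC divnK // -addnA subnK ?expn_gt0 //.
by rewrite mulnDr mulnCA expnS -[2 * _ * 2]mulnC [2 * (2 * _)]mulnA.
Qed.

Theorem theorem2p13 (n p u v t k : nat) (hn : 0 < n)
    (hp : is_peak n p) (hu : odd_before n p u) (hv : odd_after p v)
    (ht : 1 <= t) (hk : 1 <= k)
    (huk : u = 2 * 4 ^ t * k + (4 ^ t.+1 - 1) %/ 3) (hodd : odd k) :
  2 * 4 ^ t %| p /\ v = 3 * k + 2.
Proof.
have def_p : p = 2 * 4 ^ t * (3 * k + 2).
  case: hu => odd_u [i [def_u]].
  by rewrite iterS def_u /collatz odd_u huk collatz_special_form => <-.
split; first by rewrite def_p dvdn_mulr.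
apply: (@odd_after_odd_part (2 * t)); first by rewrite oddD oddM hodd.
by rewrite expnS expnM -def_p.
Qed.
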